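(* For every formula $\varphi$ of $\mathcal{L}_{\mathsf{DPL}}$, if $\varphi$ is valid in every dynamic Markov process (i.e. $\vDash\varphi$), then $\varphi$ is a theorem of $\mathcal{H}^{-}_{\mathsf{DPL}}$.
   Context: Let $\mathbb{P}$ be a countable set of propositional variables. The formulas of $\mathcal{L}_{\mathsf{DPL}}$ are given by $\varphi ::= p \mid \neg\varphi \mid \varphi\wedge\varphi \mid L_r\varphi \mid \bigcirc\varphi$ with $p\in\mathbb{P}$, $r\in\mathbb{Q}\cap[0,1]$; $\bigcirc^n$ is $n$-fold iteration of $\bigcirc$. A dynamic Markov process is $\langle\Omega,\mathcal{A},T,f\rangle$ where $\langle\Omega,\mathcal{A}\rangle$ is a measurable space, $T:\Omega\times\mathcal{A}\to[0,1]$ is a Markov kernel ($T(w,\cdot)$ is a probability measure for each $w$, $T(\cdot,A)$ is measurable for each $A$), and $f:\Omega\to\Omega$ is measurable. A model on it adds a valuation $v:\mathbb{P}\to\mathcal{A}$; satisfaction: $w\vDash p$ iff $w\in v(p)$; Boolean clauses as usual; $w\vDash L_r\varphi$ iff $T(w,[\![\varphi]\!])\ge r$ where $[\![\varphi]\!]=\{u\in\Omega\mid u\vDash\varphi\}$; $w\vDash\bigcirc\varphi$ iff $f(w)\vDash\varphi$. $\vDash\varphi$ means $\varphi$ holds at every world of every model based on every dynamic Markov process. The Hilbert system $\mathcal{H}^{-}_{\mathsf{DPL}}$ has the axiom schemes: propositional tautologies; $L_0\bot$; $L_r\neg\varphi\to\neg L_s\varphi$ if $r+s>1$; $L_r(\varphi\wedge\psi)\wedge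 L_s(\varphi\wedge\neg\psi)\to L_{r+s}\varphi$ if $r+s\le 1$; $\neg L_r(\varphi\wedge\psi)\wedge\neg L_s(\varphi\wedge\neg\psi)\to\neg L_{r+s}\varphi$ if $r+s\le1$; $L_1(\varphi\to\psi)\to(L_r\varphi\to L_r\psi)$; $\bigcirc\neg\varphi\leftrightarrow\neg\bigcirc\varphi$; $\bigcirc(\varphi\wedge\psi)\leftrightarrow(\bigcirc\varphi\wedge\bigcirc\psi)$; and rules: modus ponens; from $\{\psi\to\bigcirc^nL_s\varphi \mid s<r,\ s\in\mathbb{Q}\cap[0,1]\}$ infer $\psi\to\bigcirc^nL_r\varphi$ (each $n\in\mathbb{N}$); from $\varphi$ infer $L_1\varphi$; from $\varphi$ infer $\bigcirc\varphi$. Theorems are last elements of (possibly transfinite, countable-length) derivations in which each element is an axiom or follows by a rule from earlier elements. *)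

(* Defs.v *)
From HB Require Import structures.
From mathcomp Require Import all_boot all_order all_algebra.
From mathcomp Require Import all_classical all_reals all_analysis.
From mathcomp Require wochoice.

Set Implicit Arguments.
Unset Strict Implicit.
Unset Printing Implicit Defensive.

Import Order.TTheory GRing.Theory Num.Theory.
Local Open Scope classical_set_scope.
Local Open Scope ring_scope.

Definition unit_rat := {r : rat | 0 <= r <= 1}.

Definition u0 : unit_rat := exist _ (0 : rat) isT.
Definition u1 : unit_rat := exist _ (1 : rat) isT.

Inductive fml (P : Type) : Type :=
| Var of P
| Neg of fml P
| And of fml P & fml P
| L of unit_rat & fml P
| Next of fml P.

Definition Imp P (a b : fml P) : fml P := Neg (And a (Neg b)).
Definition Iff P (a b : fml P) : fml P := And (Imp a b) (Imp b a).

(* Falsum is not primitive: it abbreviates a contradiction p /\ ~ p. The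
   variable p is left free, so that no distinguished variable is needed. *)
Definition Bot P (p : P) : fml P := And (Var p) (Neg (Var p)).

Definition nexts P (n : nat) : fml P -> fml P := iter n (@Next P).

Record dmp (R : realType) := Dmp {
  dmp_display : measure_display;
  world : measurableType dmp_display;
  trans : R.-pker world ~> world;
  dyn : {mfun world >-> world} }.

Record model (R : realType) (P : Type) := Model {
  process : dmp R;
  valuation : P -> set (world process);
  measurable_valuation : forall p, measurable (valuation p) }.

Fixpoint truth_set (R : realType) P (M : model R P) (phi : fml P)
    : set (world (process M)) :=
  match phi with
  | Var p => @valuation R P M p
  | Neg a => ~` @truth_set R P M a
  | And a b => @truth_set R P M a `&` @truth_set R P M b
  | L r a => [set w | ((ratr (val r))%:E <= trans (process M) w (@truth_set R P M a))%E]
  | Next a => [set w | @truth_set R P M a (dyn (process M) w)]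
  end.
Arguments truth_set {R P} M phi.

Definition sat (R : realType) P (M : model R P) (w : world (process M))
  (phi : fml P) : Prop := truth_set M phi w.

Definition valid (R : realType) P (phi : fml P) : Prop :=
  forall (M : model R P) (w : world (process M)), sat w phi.

(* Kernels are total on [set world]; this shows that the clause for [L] only
   ever evaluates them on measurable sets. *)
Lemma measurable_truth_set (R : realType) P (M : model R P) (phi : fml P) :
  measurable (truth_set M phi).
Proof.
elim: phi => [p|a IH|a IHa b IHb|r a IH|a IH] /=.
- exact: measurable_valuation.
- exact: measurableC.
- exact: measurableI.
- rewrite -[X in measurable X]setTI.
  apply: measurable_lee => //.
  exact: measurable_kernel.
- rewrite -[X in measurable X]setTI.
  exact: measurable_funPT.
Qed.

(* Formulas headed by a variable, [L r] or [Next] count as propositional atoms,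
   so that the tautologies are the substitution instances of the classical
   propositional ones. *)
Fixpoint beval P (h : fml P -> bool) (phi : fml P) : bool :=
  match phi with
  | Neg a => ~~ beval h a
  | And a b => beval h a && beval h b
  | _ => h phi
  end.

Definition tautology P (phi : fml P) : Prop := forall h, beval h phi.

(* In [ax_add] and [ax_subadd], an index [t] in the unit interval with value
   [val r + val s] exists exactly when [val r + val s <= 1]. *)
Inductive axiom P : fml P -> Prop :=
| ax_taut a : tautology a -> axiom a
| ax_bot p : axiom (L u0 (Bot p))
| ax_neg r s a : val r + val s > 1 ->
    axiom (Imp (L r (Neg a)) (Neg (L s a)))
| ax_add r s t a b : val t = val r + val s ->
    axiom (Imp (And (L r (And a b)) (L s (And a (Neg b)))) (L t a))
| ax_subadd r s t a b : val t = val r + val s ->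
    axiom (Imp (And (Neg (L r (And a b))) (Neg (L s (And a (Neg b)))))
               (Neg (L t a)))
| ax_mono r a b : axiom (Imp (L u1 (Imp a b)) (Imp (L r a) (L r b)))
| ax_next_neg a : axiom (Iff (Next (Neg a)) (Neg (Next a)))
| ax_next_and a b : axiom (Iff (Next (And a b)) (And (Next a) (Next b))).

(* [rule G a]: [a] follows by one application of a rule from the set of
   premises [G]. *)
Inductive rule P : set (fml P) -> fml P -> Prop :=
| rule_mp a b : rule [set a; Imp a b] b
| rule_arch n r a b :
    rule [set Imp b (nexts n (L s a)) | s in [set s | val s < val r]]
         (Imp b (nexts n (L r a)))
| rule_L a : rule [set a] (L u1 a)
| rule_next a : rule [set a] (Next a).

(* A derivation is a family of formulas indexed by a countable well-order;
   [le j i && (j != i)] says that position [j] is strictly earlier than [i]. *)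
Definition derivation P (I : countType) (le : rel I) (d : I -> fml P) : Prop :=
  wochoice.well_order le /\
  forall i, axiom (d i) \/
    exists2 G, rule G (d i) &
      forall a, G a -> exists2 j, le j i && (j != i) & d j = a.

Definition is_theorem P (phi : fml P) : Prop :=
  exists (I : countType) (le : rel I) (d : I -> fml P) (last : I),
    [/\ derivation le d, forall i, le i last & d last = phi].

(* Main.v *)
From HB Require Import structures.
Require Import Defs.
From mathcomp Require Import all_boot all_order all_algebra.
From mathcomp Require Import all_classical all_reals all_analysis.
From mathcomp Require Import measurable_realfun lra.
From mathcomp Require wochoice.

(** If [phi] is not a theorem, [Neg phi] is consistent and a finite model
    refutes [phi].  Its worlds are the atoms of the Boolean algebra generated by
    the subformulas of [phi].  Each consistent atom is extended, by Lindenbaum's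
    construction, to a maximal consistent set closed under the Archimedean rule;
    for such a set [G], [a |-> sup {r | L r a \in G}] is a finitely additive
    probability on formulas with [L r a \in G] iff its value at [a] is at least
    [r].  Its values on the atoms are the transition probabilities, and the
    dynamics sends an atom to the atom [y] with [Next y] in its maximal
    consistent set.  Finiteness of the set of atoms turns finite additivity into
    countable additivity. *)

Set Implicit Arguments.
Unset Strict Implicit.
Unset Printing Implicit Defensive.

Import Order.TTheory GRing.Theory Num.Theory.
Local Open Scope classical_set_scope.
Local Open Scope ring_scope.

(** * Countability of the set of formulas *)

Fixpoint fml_code P (a : fml P) : GenTree.tree (P + {r : rat | 0 <= r <= 1}) :=
  match a with
  | Var p => GenTree.Leaf (inl p)
  | Neg a => GenTree.Node 0 [:: fml_code a]
  | And a b => GenTree.Node 1 [:: fml_code a; fml_code b]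
  | L r a => GenTree.Node 2 [:: GenTree.Leaf (inr r); fml_code a]
  | Next a => GenTree.Node 3 [:: fml_code a]
  end.

Fixpoint fml_decode P (t : GenTree.tree (P + {r : rat | 0 <= r <= 1})) :
    option (fml P) :=
  match t with
  | GenTree.Leaf (inl p) => Some (Var p)
  | GenTree.Node 0 [:: t] => omap (@Neg P) (fml_decode t)
  | GenTree.Node 1 [:: t; t'] =>
      obind (fun a => omap (And a) (fml_decode t')) (fml_decode t)
  | GenTree.Node 2 [:: GenTree.Leaf (inr r); t] => omap (L r) (fml_decode t)
  | GenTree.Node 3 [:: t] => omap (@Next P) (fml_decode t)
  | _ => None
  end.

Lemma fml_codeK P : pcancel (@fml_code P) (@fml_decode P).
Proof. by elim=> [p|a /= ->|a /= -> b /= ->|r a /= ->|a /= ->]. Qed.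

HB.instance Definition _ (P : countType) :=
  Countable.copy (fml P) (pcan_type (@fml_codeK P)).

(** * Concatenation of transfinite derivations *)

Definition lex_le (J : nat -> countType) (le : forall n, rel (J n)) :
    rel (option {n & J n}) := fun x y =>
  match x, y with
  | _, None => true
  | None, Some _ => false
  | Some u, Some v =>
      (tag u < tag v)%N || (tag u == tag v) && le (tag u) (tagged u) (tagged_as u v)
  end.

(** The minimum of [A] lies in the first block that meets [A] and is least there; it is [None] only
    when [A] meets no block. *)
Lemma lex_le_wo (J : nat -> countType) (le : forall n, rel (J n)) :
  (forall n, wochoice.well_order (le n)) -> wochoice.well_order (lex_le le).
Proof.
move=> wo A [x Ax].
have [[n [i Ai]]|noS] := pselect (exists n (i : J n), Some (Tagged J i) \in A).
  have exn : exists n, `[< exists i : J n, Some (Tagged J i) \in A >].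
    by exists n; apply/asboolP; exists i.
  case: (ex_minnP exn) => {i Ai n x Ax} n /asboolP[i Ai] nmin.
  have [k [[Ak kmin] kuniq]] := wo n [pred i | Some (Tagged J i) \in A] (ex_intro _ i Ai).
  have mink : wochoice.minimum_of (lex_le le) A (Some (Tagged J k)).
    split=> // -[[m j]|//] Aj /=.
    have nm : (n <= m)%N by apply: nmin; apply/asboolP; exists j.
    rewrite -/(Tagged J j) in Aj *; case: (ltngtP n m) => //= [|eqnm].
      by rewrite ltnNge nm.
    by case: m / eqnm j Aj nm => j Aj _; rewrite tagged_asE; apply: kmin.
  exists (Some (Tagged J k)); split=> // -[[m j]|] [Aj jmin]; last first.
    by have := jmin _ mink.1.
  have := jmin _ mink.1; have := mink.2 _ Aj => /=.
  case: (ltngtP n m) => //= eqnm; case: m / eqnm j Aj jmin => j Aj jmin _ _.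
  congr Some; rewrite -/(Tagged J j); congr Tagged; apply: kuniq; split=> // l Al.
  by have := jmin _ Al; rewrite /= ltnn eqxx tagged_asE.
exists None; split; last first.
  move=> [[m j]|//] [Aj _]; exfalso; apply: noS.
  by exists m, j.
have AS : forall y, y \in A -> y = None.
  by move=> [[m j]|//] Aj; exfalso; apply: noS; exists m, j.
by split=> [|y /AS ->//]; rewrite -(AS _ Ax).
Qed.

(* The derivations of the premises are concatenated in lexicographic order, with
   the new conclusion [None] on top; formulas outside [G] contribute the empty
   derivation. *)
Lemma is_theorem_intro (P : countType) (G : set (fml P)) (a : fml P) :
  Defs.axiom a \/ rule G a -> (forall b, G b -> is_theorem b) -> is_theorem a.
Proof.
move=> aG thG.
have /choice[D HD] : forall n : nat, exists D :
    {I : countType & (rel I * (I -> fml P))%type},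
    derivation (tagged D).1 (tagged D).2 /\
    forall b, unpickle n = Some b -> G b -> exists i, (tagged D).2 i = b.
  move=> n; have [[b [nb Gb]]|noG] :=
      pselect (exists b, unpickle n = Some b /\ G b).
    have [I [le [d [l [der _ dl]]]]] := thG b Gb.
    exists (Tagged (fun I : countType => (rel I * (I -> fml P))%type) (le, d)).
    split=> //= c; rewrite nb => -[<- _]; by exists l.
  exists (Tagged (fun I : countType => (rel I * (I -> fml P))%type)
    ((fun _ _ : void => true), (fun v : void => match v with end))).
  split=> [|b nb Gb]; last by case: noG; exists b.
  by split=> [A [[]]|[]].
pose J n : countType := tag (D n).
pose le n : rel (J n) := (tagged (D n)).1.
pose d (x : option {n & J n}) : fml P :=
  if x is Some u then (tagged (D (tag u))).2 (tagged u) else a.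
exists (option {n & J n}), (lex_le le), d, None.
split=> //; last by move=> [].
split=> [|[[n i]|]].
- by apply: lex_le_wo => n; have [[]] := HD n.
- have [[_ /(_ i)[ax|[H rH prem]]] _] := HD n; [by left|right].
  exists H => // b /prem[j /andP[ji nji] jb].
  exists (Some (Tagged J j)) => //=.
  rewrite ltnn eqxx tagged_asE [X in X && _]ji /=.
  by apply: contra nji => /eqP[] /eqP; rewrite eq_Tagged.
- case: aG => [ax|rG]; [by left|right]; exists G => // b Gb.
  have [i ib] := (HD (pickle b)).2 b (pickleK b) Gb.
  by exists (Some (Tagged J i)).
Qed.

(** * Derived rules of the Hilbert system *)

Lemma thm_axiom (P : countType) (a : fml P) : Defs.axiom a -> is_theorem a.
Proof. by move=> ax; apply: (@is_theorem_intro _ set0) => //; left. Qed.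

Lemma thm_rule (P : countType) (G : set (fml P)) (a : fml P) :
  rule G a -> (forall b, G b -> is_theorem b) -> is_theorem a.
Proof. by move=> rG; apply: is_theorem_intro; right. Qed.

Lemma thm_mp (P : countType) (a b : fml P) :
  is_theorem (Imp a b) -> is_theorem a -> is_theorem b.
Proof. by move=> ab ta; apply: (thm_rule (rule_mp a b)) => c [->|->]. Qed.

Lemma thm_L1 (P : countType) (a : fml P) : is_theorem a -> is_theorem (L u1 a).
Proof. by move=> ta; apply: (thm_rule (rule_L a)) => _ ->. Qed.

Lemma thm_next (P : countType) (a : fml P) : is_theorem a -> is_theorem (Next a).
Proof. by move=> ta; apply: (thm_rule (rule_next a)) => _ ->. Qed.

Lemma thm_arch (P : countType) (r : unit_rat) (a b : fml P) :
  (forall s : unit_rat, val s < val r -> is_theorem (Imp b (L s a))) ->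
  is_theorem (Imp b (L r a)).
Proof. by move=> H; apply: (thm_rule (rule_arch 0 r a b)) => _ [s sr <-]; apply: H. Qed.

Lemma thm_taut (P : countType) (a : fml P) : tautology a -> is_theorem a.
Proof. by move=> ta; apply/thm_axiom/ax_taut. Qed.

Lemma thm_taut1 (P : countType) (a b : fml P) :
  tautology (Imp a b) -> is_theorem a -> is_theorem b.
Proof. by move=> /thm_taut; apply: thm_mp. Qed.

Lemma thm_taut2 (P : countType) (a b c : fml P) :
  tautology (Imp a (Imp b c)) -> is_theorem a -> is_theorem b -> is_theorem c.
Proof. by move=> tabc ta; apply: thm_mp; apply: thm_taut1 ta. Qed.

(** A truth table over the values of the subformulas at which [beval] cannot reduce further. *)
Ltac taut := let h := fresh "h" in
  move=> h /=; repeat match goal with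
  | |- context [beval h ?x] => case: (beval h x)
  | |- context [h ?x] => case: (h x)
  end; by [].

Lemma thm_imp_trans (P : countType) (a b c : fml P) :
  is_theorem (Imp a b) -> is_theorem (Imp b c) -> is_theorem (Imp a c).
Proof. by apply: thm_taut2; taut. Qed.

Lemma thm_imp_weaken (P : countType) (a b : fml P) :
  is_theorem b -> is_theorem (Imp a b).
Proof. by apply: thm_taut1; taut. Qed.

Lemma thm_imp_refl (P : countType) (a : fml P) : is_theorem (Imp a a).
Proof. by apply: thm_taut; taut. Qed.

(** * Maximal consistent sets and Lindenbaum's construction *)

Definition consistent P (a : fml P) : Prop := ~ is_theorem (Neg a).

(** Consistency is the left-to-right half of [mcs_neg], maximality the other half. *)
Record mcs (P : Type) (G : set (fml P)) : Prop := Mcs {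
  mcs_thm : forall a, is_theorem a -> G a;
  mcs_mp : forall a b, G (Imp a b) -> G a -> G b;
  mcs_neg : forall a, G (Neg a) <-> ~ G a }.

Definition archimedean P (G : set (fml P)) : Prop := forall (r : unit_rat) a,
  (forall s : unit_rat, val s < val r -> G (L s a)) -> G (L r a).

(* The Archimedean rule supplies the witness [s] when [L r a] is refused. *)
Lemma lindenbaum_step (P : countType) (x b : fml P) : consistent x ->
  exists y, [/\ consistent y, is_theorem (Imp y x) &
    is_theorem (Imp y b) \/ is_theorem (Imp y (Neg b)) /\
      forall (r : unit_rat) a, b = L r a ->
        exists2 s : unit_rat, val s < val r & is_theorem (Imp y (Neg (L s a)))].
Proof.
move=> cx; have [nxb|cxb] := pselect (is_theorem (Neg (And x b))); last first.
  exists (And x b); split=> //; first by apply: thm_taut; taut.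
  by left; apply: thm_taut; taut.
have cxnb : consistent (And x (Neg b)).
  by move=> nxnb; apply: cx; apply: thm_taut2 nxb nxnb; taut.
have [[r [a bE]]|noL] := pselect (exists r a, b = L r a); last first.
  exists (And x (Neg b)); split=> //; first by apply: thm_taut; taut.
  right; split=> [|r a bE]; first by apply: thm_taut; taut.
  by case: noL; exists r, a.
rewrite {}bE in nxb cxnb *.
have [y yE] : exists y, y = And x (Neg (L r a)) by exists (And x (Neg (L r a))).
have yx : is_theorem (Imp y x) by rewrite yE; apply: thm_taut; taut.
have yNr : is_theorem (Imp y (Neg (L r a))) by rewrite yE; apply: thm_taut; taut.
have [[s [sr cs]]|nos] := pselect (exists s : unit_rat, val s < val r /\
    consistent (And y (Neg (L s a)))).
  exists (And y (Neg (L s a))); split=> //; first by apply: thm_taut1 yx; taut.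
  right; split=> [|_ _ [<- <-]]; first by apply: thm_taut1 yNr; taut.
  by exists s => //; apply: thm_taut; taut.
(* Without a witness, [y] provably implies every [L s a] with [s < r], hence [L r a] by the
   Archimedean rule, and this refutes [x]. *)
exfalso; apply: cx; suff yr : is_theorem (Imp y (L r a)).
  by rewrite yE in yr; apply: thm_taut2 nxb yr; taut.
apply: thm_arch => s sr; apply: contrapT => cs; apply: nos; by exists s.
Qed.

(** A chain of ever stronger single formulas suffices: each stage decides the formula that it codes,
    and [G] collects all consequences of the chain. A refused [L r a] comes with a refused [L s a],
    [s < r], whence Archimedean closure. *)
Lemma lindenbaum (P : countType) (x : fml P) : consistent x ->
  exists G, [/\ mcs G, archimedean G & G x].
Proof.
move=> cx.
have /choice[f Hf] : forall xb : fml P * fml P, exists y : fml P,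
    consistent xb.1 -> [/\ consistent y, is_theorem (Imp y xb.1) &
    is_theorem (Imp y xb.2) \/ is_theorem (Imp y (Neg xb.2)) /\
      forall (r : unit_rat) a, xb.2 = L r a ->
        exists2 s : unit_rat, val s < val r & is_theorem (Imp y (Neg (L s a)))].
  move=> [z b] /=; have [cz|ncz] := pselect (consistent z); last by exists z.
  by have [y Hy] := lindenbaum_step b cz; exists y.
pose X := fix X n := if n is m.+1 then
  (if unpickle m is Some b then f (X m, b) else X m) else x.
have cX n : consistent (X n).
  elim: n => //= n IH; case: unpickle => // b.
  by have [] := Hf (X n, b) IH.
have XS n : is_theorem (Imp (X n.+1) (X n)).
  rewrite /=; case: unpickle => [b|]; last exact: thm_imp_refl.
  by have [] := Hf (X n, b) (cX n).
have Xle n m : (n <= m)%N -> is_theorem (Imp (X m) (X n)).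
  move=> /subnK <-; elim: (m - n)%N => [|k IH]; first exact: thm_imp_refl.
  by rewrite addSn; apply: thm_imp_trans (XS _) IH.
pose G : set (fml P) := [set a | exists n, is_theorem (Imp (X n) a)].
have GI a b c : tautology (Imp a (Imp b c)) -> G a -> G b -> G c.
  move=> abc [n na] [m mb]; exists (maxn n m).
  have nx := thm_imp_trans (Xle _ _ (leq_maxl n m)) na.
  have mx := thm_imp_trans (Xle _ _ (leq_maxr n m)) mb.
  have : is_theorem (Imp (X (maxn n m)) (And a b)).
    by apply: thm_taut2 nx mx; taut.
  move/thm_imp_trans; apply; apply: thm_taut1 (thm_taut abc); taut.
have Gbot a : G (Neg a) -> ~ G a.
  move=> Gna Ga; have [n nn] : G (Neg (Imp a a)) by apply: GI Gna Ga; taut.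
  by apply: (cX n); apply: thm_taut1 nn; taut.
have Gdec b : G b \/ G (Neg b) /\ forall (r : unit_rat) a, b = L r a ->
    exists2 s : unit_rat, val s < val r & G (Neg (L s a)).
  (* Stage [pickle b] treats [b], so the decision is visible in [X (pickle b).+1]. *)
  have [_ _] := Hf (X (pickle b), b) (cX _) => /= H.
  have Gf c : is_theorem (Imp (f (X (pickle b), b)) c) -> G c.
    by move=> tc; exists (pickle b).+1; rewrite /= pickleK.
  case: H => [/Gf|[/Gf nb wit]]; [by left|right; split=> // r a /wit[s sr /Gf Gs]].
  by exists s.
exists G; split; last by exists 0%N; exact: thm_imp_refl.
- split=> [a ta|a b|a]; first by exists 0%N; apply: thm_imp_weaken.
    by apply: GI; taut.
  by split=> [/Gbot //|nGa]; case: (Gdec a) => [|[]].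
- move=> r a Gs; case: (Gdec (L r a)) => // -[_ /(_ _ _ erefl)[s sr /Gbot]].
  by case; apply: Gs.
Qed.

(** * Closure properties of maximal consistent sets *)

Lemma mcs_imp (P : countType) (G : set (fml P)) (a b : fml P) :
  mcs G -> is_theorem (Imp a b) -> G a -> G b.
Proof. by move=> mG /(mcs_thm mG); apply: mcs_mp. Qed.

Lemma mcs_and (P : countType) (G : set (fml P)) (a b : fml P) :
  mcs G -> G (And a b) <-> G a /\ G b.
Proof.
move=> mG; split=> [ab|[Ga Gb]].
  by split; apply: mcs_imp mG _ ab; apply: thm_taut; taut.
apply: (mcs_mp mG _ Gb); apply: mcs_imp mG _ Ga; apply: thm_taut; taut.
Qed.

Lemma mcs_iff (P : countType) (G : set (fml P)) (a b : fml P) :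
  mcs G -> is_theorem (Iff a b) -> G a <-> G b.
Proof.
move=> mG ab; split; apply: mcs_imp mG _; apply: thm_taut1 ab; taut.
Qed.

Lemma mcs_consistent (P : countType) (G : set (fml P)) (a : fml P) :
  mcs G -> G a -> consistent a.
Proof. by move=> mG Ga /(mcs_thm mG)/(mcs_neg mG). Qed.

(** [Next] commutes with negation and conjunction, so taking the preimage under it preserves every
    clause of [mcs]. *)
Lemma mcs_next (P : countType) (G : set (fml P)) :
  mcs G -> mcs [set a | G (Next a)].
Proof.
move=> mG.
have negN a : G (Next (Neg a)) <-> ~ G (Next a).
  by rewrite -(mcs_neg mG); apply: mcs_iff mG _; apply/thm_axiom/ax_next_neg.
have andN a b : G (Next (And a b)) <-> G (Next a) /\ G (Next b).
  by rewrite -(mcs_and _ _ mG); apply: mcs_iff mG _; apply/thm_axiom/ax_next_and.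
split=> [a /thm_next/(mcs_thm mG)//|a b /negN nab Ga|a]; last exact: negN.
by apply: contrapT => /negN nb; apply: nab; apply/andN.
Qed.

Lemma mcs_L_imp (P : countType) (G : set (fml P)) (r : unit_rat) (a b : fml P) :
  mcs G -> is_theorem (Imp a b) -> G (L r a) -> G (L r b).
Proof.
move=> mG /thm_L1 ab; apply: mcs_imp mG _; apply: thm_mp ab.
exact/thm_axiom/ax_mono.
Qed.

(** [L u1 (Neg a)] is in [G], and [1 + r > 1] makes [ax_neg] applicable. *)
Lemma mcs_L_absurd (P : countType) (G : set (fml P)) (r : unit_rat) (a : fml P) :
  mcs G -> is_theorem (Neg a) -> 0 < val r -> ~ G (L r a).
Proof.
move=> mG /thm_L1/(mcs_thm mG) na r0; apply/(mcs_neg mG); apply: mcs_imp mG _ na.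
by apply/thm_axiom/ax_neg; rewrite ltrDl.
Qed.

Lemma mcs_L_add (P : countType) (G : set (fml P)) (r s t : unit_rat) (a b : fml P) :
  mcs G -> val t = val r + val s ->
  G (L r (And a b)) -> G (L s (And a (Neg b))) -> G (L t a).
Proof.
move=> mG trs Gr Gs; apply: mcs_imp mG _ (proj2 (mcs_and _ _ mG) (conj Gr Gs)).
exact/thm_axiom/ax_add.
Qed.

Lemma mcs_L_subadd (P : countType) (G : set (fml P)) (r s t : unit_rat)
    (a b : fml P) : mcs G -> val t = val r + val s ->
  ~ G (L r (And a b)) -> ~ G (L s (And a (Neg b))) -> ~ G (L t a).
Proof.
move=> mG trs /(mcs_neg mG) Gr /(mcs_neg mG) Gs; apply/(mcs_neg mG).
apply: mcs_imp mG _ (proj2 (mcs_and _ _ mG) (conj Gr Gs)).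
exact/thm_axiom/ax_subadd.
Qed.

Lemma unit_rat_ge0 (r : unit_rat) : 0 <= val r.
Proof. by have /andP[] := valP r. Qed.

Lemma unit_rat_le1 (r : unit_rat) : val r <= 1.
Proof. by have /andP[] := valP r. Qed.

(** Split [a] by itself and [r] as [s + (r - s)]: if [L s a] failed, then, [And a (Neg a)] being
    absurd, [ax_subadd] would refute [L r a]. *)
Lemma mcs_L_le (P : countType) (G : set (fml P)) (r s : unit_rat) (a : fml P) :
  mcs G -> val s <= val r -> G (L r a) -> G (L s a).
Proof.
move=> mG; rewrite le_eqVlt => /predU1P[/val_inj -> //|sr] Gr.
apply: contrapT => nGs.
have t01 : 0 <= val r - val s <= 1.
  by move: (unit_rat_le1 r) (unit_rat_ge0 s); lra.
pose t : unit_rat := exist _ (val r - val s) t01.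
apply: (@mcs_L_subadd _ G s t r a a) Gr => //=.
- by rewrite addrC subrK.
- by apply: contra_not nGs; apply: mcs_L_imp mG _; apply: thm_taut; taut.
- by apply: mcs_L_absurd => //=; [apply: thm_taut; taut|rewrite subr_gt0].
Qed.

(** * Atoms of a finite list of formulas *)

(* [t] is a theorem closing each conjunction: no closed formula is available to
   play the role of [True]. *)
Fixpoint atoms P (t : fml P) (s : seq (fml P)) : seq (fml P) :=
  if s is a :: s' then
    map (And a) (atoms t s') ++ map (And (Neg a)) (atoms t s')
  else [:: t].

Lemma atoms_decide (P : countType) (t : fml P) (s : seq (fml P)) (a y : fml P) :
  a \in s -> y \in atoms t s -> is_theorem (Imp y a) \/ is_theorem (Imp y (Neg a)).
Proof.
elim: s y => //= b s IH y; rewrite inE mem_cat => /predU1P[->|/IH{}IH].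
  by case/orP=> /mapP[z _ ->]; [left|right]; apply: thm_taut; taut.
by case/orP=> /mapP[z /IH[] za ->]; [left|right|left|right];
  apply: thm_taut1 za; taut.
Qed.

(** Each formula of [s] is taken with the sign that [G] gives it. *)
Lemma mcs_atom (P : countType) (G : set (fml P)) (t : fml P) (s : seq (fml P)) :
  mcs G -> is_theorem t -> exists2 y, y \in atoms t s & G y.
Proof.
move=> mG tt; elim: s => [|a s [y ys Gy]] /=.
  by exists t; [rewrite inE|exact: mcs_thm].
have [Ga|nGa] := pselect (G a).
  exists (And a y); last exact/mcs_and.
  by rewrite mem_cat map_f.
exists (And (Neg a) y); last by apply/mcs_and => //; split=> //; apply/(mcs_neg mG).
by rewrite mem_cat [X in _ || X]map_f ?orbT.
Qed.

(** * The finitely additive probability of a maximal consistent set *)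

Definition mu (R : realType) P (G : set (fml P)) (a : fml P) : R :=
  sup [set x | exists2 r, G (L r a) & ratr (val r) = x].

Section Measure.
Context (R : realType) (P : countType) (G : set (fml P)).
Hypotheses (mG : mcs G) (aG : archimedean G).
Local Notation mu := (mu R G).

(** No index lies below 0, so the Archimedean premise is vacuous. *)
Lemma mcs_L0 a : G (L u0 a).
Proof. by apply: aG => s; rewrite /= ltNge unit_rat_ge0. Qed.

Lemma mu_has_sup a : has_sup [set x : R | exists2 r, G (L r a) & ratr (val r) = x].
Proof.
split; first by exists (ratr (val u0)); exists u0 => //; apply: mcs_L0.
by exists 1 => _ [r _ <-]; rewrite -(rmorph1 (@ratr R)) ler_rat unit_rat_le1.
Qed.

(** From right to left, each [s < r] lies strictly below the supremum, so [L s a] is in [G];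
    [archimedean] then reaches [r] itself. *)
Lemma muP r a : G (L r a) <-> ratr (val r) <= mu a.
Proof.
split=> [Gr|rmu].
  apply: sup_ubound; last by exists r.
  exact: (mu_has_sup a).2.
apply: aG => s sr; have smu : ratr (val s) < mu a.
  by apply: lt_le_trans rmu; rewrite ltr_rat.
have [_ [t Gt <-]] := sup_gt (mu_has_sup a).1 smu.
by rewrite ltr_rat => /ltW st; apply: mcs_L_le Gt.
Qed.

Lemma mu_ge0 a : 0 <= mu a.
Proof. by have /muP := mcs_L0 a; rewrite rmorph0. Qed.

Lemma mu_le a x : (forall r, G (L r a) -> ratr (val r) <= x) -> mu a <= x.
Proof.
move=> H; apply: ge_sup => [|_ [r Gr <-]]; last exact: H.
exact: (mu_has_sup a).1.
Qed.

Lemma mu_mono a b : is_theorem (Imp a b) -> mu a <= mu b.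
Proof. by move=> ab; apply: mu_le => r /(mcs_L_imp mG ab)/muP. Qed.

Lemma mu_eq a b : is_theorem (Imp a b) -> is_theorem (Imp b a) -> mu a = mu b.
Proof. by move=> ab ba; apply/le_anti; rewrite !mu_mono. Qed.

Lemma mu_absurd a : is_theorem (Neg a) -> mu a = 0.
Proof.
move=> na; apply/le_anti; rewrite mu_ge0 andbT; apply: mu_le => r Gr.
rewrite -(rmorph0 (@ratr R)) ler_rat leNgt; apply/negP => r0.
exact: mcs_L_absurd Gr.
Qed.

Lemma mu_thm a : is_theorem a -> mu a = 1.
Proof.
move=> ta; apply/le_anti/andP; split.
  by apply: mu_le => r _; rewrite -(rmorph1 (@ratr R)) ler_rat unit_rat_le1.
by have /muP := mcs_thm mG (thm_L1 ta); rewrite rmorph1.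
Qed.

(** [ax_subadd] bounds the left side by the right one, [ax_add] the converse. *)
Lemma mu_split a b : mu a = mu (And a b) + mu (And a (Neg b)).
Proof.
apply/le_anti/andP; split.
  apply: mu_le => r Gr; rewrite leNgt; apply/negP => lt_r.
  (* A rational [q] in this gap splits [r] into [q] and [r - q], each strictly above the value of
     its half of [a]. *)
  have : mu (And a b) < ratr (val r) - mu (And a (Neg b)) by rewrite ltrBrDr.
  move=> /rat_in_itvoo[q]; rewrite in_itv /= => /andP[q1 q2].
  have q0 : 0 <= q.
    by rewrite -(ler_rat R) rmorph0; apply: le_trans (ltW q1); apply: mu_ge0.
  have rq : mu (And a (Neg b)) < ratr (val r - q).
    by rewrite rmorphB /=; move: q2; lra.
  have rq0 : 0 <= val r - q.
    by rewrite -(ler_rat R) rmorph0; apply: le_trans (ltW rq); apply: mu_ge0.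
  have r1 := unit_rat_le1 r.
  have Q1 : 0 <= q <= 1 by lra.
  have Q2 : 0 <= val r - q <= 1 by lra.
  apply: (@mcs_L_subadd _ G (exist _ q Q1) (exist _ (val r - q) Q2) r a b) Gr => //=.
  - by rewrite addrC subrK.
  - by move/muP; rewrite leNgt q1.
  - by move/muP; rewrite leNgt rq.
rewrite -lerBrDr; apply: mu_le => r Gr; rewrite lerBrDr addrC -lerBrDr.
apply: mu_le => s Gs; rewrite lerBrDr addrC -rmorphD /=.
(* A sum above 1 is no index, but [ax_neg] excludes it, as [And a b] implies
   [Neg (And a (Neg b))]. *)
have [rs1|rs1] := leP (val r + val s) 1; last first.
  have /(mcs_L_imp mG) /(_ Gr) : is_theorem (Imp (And a b) (Neg (And a (Neg b)))).
    by apply: thm_taut; taut.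
  by move/(mcs_imp mG (thm_axiom (ax_neg _ rs1)))/(mcs_neg mG).
have rs01 : 0 <= val r + val s <= 1 by rewrite rs1 addr_ge0 ?unit_rat_ge0.
pose t : unit_rat := exist _ (val r + val s) rs01.
by apply/(muP t); apply: (@mcs_L_add _ G r s t a b).
Qed.

Lemma mu_atoms t s b : is_theorem t ->
  mu b = \sum_(y <- atoms t s) mu (And b y).
Proof.
move=> tt; elim: s b => [|a s IH] b /=.
  rewrite big_seq1; apply: mu_eq; last by apply: thm_taut; taut.
  by apply: thm_taut1 tt; taut.
rewrite big_cat /= !big_map (mu_split b a) (IH (And b a)) (IH (And b (Neg a))).
by congr (_ + _); apply: eq_bigr => y _; apply: mu_eq; apply: thm_taut; taut.
Qed.

End Measure.

(** * Markov kernels with finite support on the natural numbers *)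

Section FiniteSupportKernel.
Context (R : realType) (m : nat) (p : nat -> nat -> R).
Hypotheses (p0 : forall n k, 0 <= p n k) (p1 : forall n, \sum_(k < m) p n k = 1).

(** As a finite sum of weighted Dirac measures, it inherits countable additivity. *)
Definition finite_support_kernel (n : nat) : {measure set nat -> \bar R} :=
  msum (fun k => mscale (NngNum (p0 n k)) (\d_(k))) m.
Local Notation K := finite_support_kernel.

Lemma finite_support_kernelE n U :
  K n U = (\sum_(k < m) p n k * \1_U (k : nat))%:E.
Proof.
by rewrite /K /= /msum -sumEFin; apply: eq_bigr => k _; rewrite EFinM.
Qed.

Let measurable_kernel U : measurable U -> measurable_fun [set: nat] (K ^~ U).
Proof. by []. Qed.

HB.instance Definition _ := isKernel.Build _ _ _ _ R K measurable_kernel.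

Let prob_kernel n : K n setT = 1%E.
Proof.
rewrite finite_support_kernelE; congr EFin; rewrite -[RHS](p1 n).
by apply: eq_bigr => k _; rewrite indicT mulr1.
Qed.

HB.instance Definition _ := Kernel_isProbability.Build _ _ _ _ R K prob_kernel.

Definition finite_support_pker : R.-pker nat ~> nat := K.

End FiniteSupportKernel.

(** * The model of atoms and its truth lemma *)

Fixpoint subformulas P (a : fml P) : seq (fml P) :=
  a :: match a with
  | Var _ => [::]
  | And b c => subformulas b ++ subformulas c
  | Neg b | L _ b | Next b => subformulas b
  end.

Lemma mem_subformulas (P : countType) (a : fml P) : a \in subformulas a.
Proof. by case: a => *; rewrite inE eqxx. Qed.

Lemma measurable_nat_fun (g : nat -> nat) : measurable_fun setT g.
Proof. by []. Qed.

HB.instance Definition _ (g : nat -> nat) :=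
  isMeasurableFun.Build _ _ nat nat g (measurable_nat_fun g).

Section Filtration.
Context (R : realType) (P : countType) (t : fml P) (s : seq (fml P)).
Context (G : fml P -> set (fml P)) (g : nat -> nat).
Let A := atoms t s.
(** Every natural number is a world; those beyond [size A] get the default [t], and neither [g] nor
    the kernel, supported on [k < size A], leads to them. *)
Let x := nth t A.
Hypotheses (tt : is_theorem t) (mG : forall a, mcs (G a)).
Hypotheses (aG : forall a, archimedean (G a)).
Hypotheses (cG : forall a, consistent a -> G a a).
Hypotheses (g_lt : forall i, (g i < size A)%N).
Hypotheses (g_next : forall i, G (x i) (Next (x (g i)))).

Lemma filtration_sum i b :
  mu R (G (x i)) b = \sum_(k < size A) mu R (G (x i)) (And b (x k)).
Proof. by rewrite (mu_atoms R (mG _) (@aG _) s b tt) (big_nth t) big_mkord. Qed.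

Let p i k := mu R (G (x i)) (x k).

Let p_ge0 i k : 0 <= p i k.
Proof. exact: mu_ge0. Qed.

Let p_sum1 i : \sum_(k < size A) p i k = 1.
Proof.
rewrite -(mu_thm R (mG (x i)) (@aG (x i)) tt) filtration_sum.
apply: eq_bigr => k _; apply: mu_eq => //; last by apply: thm_taut; taut.
by apply: thm_taut1 tt; taut.
Qed.

(* The world [i] is the [i]-th atom; natural numbers carry the discrete
   sigma-algebra. *)
Definition filtration : model R P :=
  @Model R P (@Dmp R _ nat (finite_support_pker p_ge0 p_sum1) g)
    (fun q => [set i | G (x i) (Var q)]) (fun _ => I).

Lemma atom_decide a k : a \in s -> (k < size A)%N ->
  is_theorem (Imp (x k) a) \/ is_theorem (Imp (x k) (Neg a)).
Proof. by move=> sa kA; apply: (atoms_decide sa (mem_nth t kA)). Qed.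

(** Consistent atoms decide every formula of [s], so any two maximal consistent sets containing the
    same atom agree on [s]. This transfers membership between [G (x i)] and the sets of its
    successors. *)
Lemma filtration_truth (a : fml P) : {subset subformulas a <= s} ->
  forall i, (i < size A)%N -> consistent (x i) ->
  truth_set filtration a i <-> G (x i) a.
Proof.
elim: a => [q|a IH|a IHa b IHb|r a IH|a IH] sub i iA ci //=.
- rewrite (mcs_neg (mG _)) -IH // => b ab.
  by apply: sub; rewrite inE ab orbT.
- rewrite (mcs_and _ _ (mG _)) -IHa // => [|c ac].
    by rewrite -IHb // => c bc; apply: sub; rewrite inE mem_cat bc !orbT.
  by apply: sub; rewrite inE mem_cat ac !orbT.
- have {sub}sub b : b \in subformulas a -> b \in s.
    by move=> ab; apply: sub; rewrite inE ab orbT.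
  rewrite (muP R (mG _) (@aG _)) filtration_sum.
  rewrite [X in (_ <= X)%E]finite_support_kernelE lee_fin.
  suff -> : \sum_(k < size A) p i k * \1_(truth_set filtration a) (k : nat) =
      \sum_(k < size A) mu R (G (x i)) (And a (x k)) by [].
  apply: eq_bigr => k _; rewrite /p.
  (* The induction hypothesis says nothing about an inconsistent atom, but its weight is 0 on both
     sides. *)
  have [nk|ck] := pselect (is_theorem (Neg (x k))).
    rewrite !mu_absurd ?mul0r //; apply: thm_taut1 nk; taut.
  have [ka|kna] := atom_decide (sub _ (mem_subformulas a)) (ltn_ord k).
    rewrite indicE mem_set ?mulr1; last first.
      by apply/IH => //; apply: mcs_imp (mG _) ka _; apply: cG.
    by apply: mu_eq => //; [apply: thm_taut1 ka|apply: thm_taut]; taut.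
  rewrite indicE memNset ?mulr0 ?mu_absurd //; first by apply: thm_taut1 kna; taut.
  move=> /IH; move/(_ sub (ltn_ord k) ck); apply/(mcs_neg (mG _)).
  by apply: mcs_imp (mG _) kna _; apply: cG.
- have {sub}sub b : b \in subformulas a -> b \in s.
    by move=> ab; apply: sub; rewrite inE ab orbT.
  have mN := mcs_next (mG (x i)).
  have cg : consistent (x (g i)) by apply: mcs_consistent mN _; apply: g_next.
  (* [G (x (g i))] and the preimage of [G (x i)] under [Next] both contain [x (g i)], which decides
     [a]. *)
  have iff_g : G (x (g i)) a <-> G (x i) (Next a).
    have [ga|gna] := atom_decide (sub _ (mem_subformulas a)) (g_lt i).
      by split=> _; [apply: mcs_imp mN ga _; apply: g_next|
                     apply: mcs_imp (mG _) ga _; apply: cG].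
    have /(mcs_neg mN) nN := mcs_imp mN gna (g_next i).
    by have /(mcs_neg (mG _)) nG := mcs_imp (mG _) gna (cG cg); split.
  by rewrite -iff_g -IH.
Qed.

End Filtration.

(** * Completeness *)

Theorem theorem2p14 (R : realType) (P : countType) (phi : fml P) :
  valid R phi -> is_theorem phi.
Proof.
move=> phi_valid; apply: contrapT => nphi.
have cphi : consistent (Neg phi).
  by move=> nn; apply: nphi; apply: thm_taut1 nn; taut.
have [G0 [mG0 aG0 G0phi]] := lindenbaum cphi.
have /choice[G HG] : forall a : fml P, exists G,
    [/\ mcs G, archimedean G & consistent a -> G a].
  move=> a; have [/lindenbaum[G [mG aG Ga]]|nca] := pselect (consistent a).
    by exists G.
  (* An inconsistent formula gets an arbitrary maximal consistent set, so that the model is defined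
     at every world. *)
  by exists G0.
have mG a : mcs (G a) by have [] := HG a.
have aG a : archimedean (G a) by have [] := HG a.
have cG a : consistent a -> G a a by have [] := HG a.
pose t := Imp phi phi; have tt : is_theorem t := thm_imp_refl phi.
pose s := subformulas phi; pose x := nth t (atoms t s).
have /choice[g Hg] : forall i, exists j, (j < size (atoms t s))%N /\
    G (x i) (Next (x j)).
  move=> i; have [y yA Gy] := mcs_atom s (mcs_next (mG (x i))) tt.
  by exists (index y (atoms t s)); rewrite index_mem yA /x nth_index.
(* The refuting world is the atom that belongs to [G0], which contains [Neg phi]. *)
have [y yA Gy] := mcs_atom s mG0 tt.
have cy : consistent (x (index y (atoms t s))).
  by rewrite /x nth_index //; apply: mcs_consistent Gy.
have g_lt i := (Hg i).1; have g_next i := (Hg i).2.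
have := phi_valid (@filtration R P t s G g tt mG aG) (index y (atoms t s)).
move/(@filtration_truth R P t s G g tt mG aG cG g_lt g_next phi (fun _ => id)).
rewrite index_mem -/(x _) => /(_ yA cy); rewrite /x nth_index //.
have [yphi|ynphi] := atoms_decide (mem_subformulas phi) yA => Gphi.
  by apply: (proj1 (mcs_neg mG0 phi) G0phi); apply: mcs_imp Gy.
apply: (proj1 (mcs_neg (mG y) phi)) Gphi; apply: mcs_imp (mG y) ynphi _.
by apply: cG; apply: mcs_consistent Gy.
Qed.
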